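(* Let $\alpha>0$. Let $(A(t),B(t))$, with $A(t)>0$ and $B(t)>0$, be any solution of the system $$\frac{dA}{dt}=-\frac{4A^2B^2+2\alpha A^3}{B^4},\qquad \frac{dB}{dt}=\frac{4AB^2-8B^3-10\alpha A^2-16\alpha B^2+24\alpha AB}{B^3},$$ with initial data $(A(0),B(0))=(A_0,B_0)$, $A_0>0$, $B_0>0$, defined on its maximal forward interval of existence $[0,t_{\max})$. Then the solution becomes singular in finite time, i.e. $t_{\max}<\infty$, and $(A(t),B(t))\to(0,0)$ as $t\to t_{\max}$.
   Context: The system is the second-order renormalization group (RG-2) flow $\partial_t g_{ij}=-2R_{ij}-\frac{\alpha}{2}R_{iklm}R_j{}^{klm}$, with coupling constant $\alpha>0$, restricted to homogeneous $\mathrm{SU}(2)$ metrics that are diagonal with components $(A,B,C)$ in a fixed left-invariant (Milnor) frame and satisfy the local rotational symmetry condition $B=C$. Solutions are considered in the open quarter plane $\{A>0,\,B>0\}$, and $[0,t_{\max})$, $0<t_{\max}\le\infty$, denotes the maximal interval on which the solution exists in that region. *)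

(* Defs.v *)
From Stdlib Require Import Reals.
From Coquelicot Require Import Coquelicot.
Open Scope R_scope.

Definition dA_dt (alpha A B : R) : R :=
  - ((4 * A^2 * B^2 + 2 * alpha * A^3) / B^4).

Definition dB_dt (alpha A B : R) : R :=
  (4 * A * B^2 - 8 * B^3 - 10 * alpha * A^2 - 16 * alpha * B^2
   + 24 * alpha * A * B) / B^3.

Definition forward_interval (T : Rbar) (t : R) : Prop :=
  0 <= t /\ Rbar_lt t T.

(** [D_in f df D t] is the derivative of [f] at [t] relative to the domain [D]:
    on [[0, T)] it is the two-sided derivative for [0 < t] and the right
    derivative at [0], so values of [A] and [B] outside [[0, T)] play no role. *)
Definition is_solution (alpha : R) (T : Rbar) (A B : R -> R) : Prop :=
  Rbar_lt 0 T /\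
  forall t : R, forward_interval T t ->
    0 < A t /\ 0 < B t /\
    D_in A (fun s => dA_dt alpha (A s) (B s)) (forward_interval T) t /\
    D_in B (fun s => dB_dt alpha (A s) (B s)) (forward_interval T) t.

(** Maximality is relative to the open quarter plane: an extension must also
    satisfy [A > 0] and [B > 0]. *)
Definition is_maximal_solution
    (alpha : R) (tmax : Rbar) (A B : R -> R) : Prop :=
  is_solution alpha tmax A B /\
  forall (T : Rbar) (A' B' : R -> R),
    is_solution alpha T A' B' ->
    (forall t : R, forward_interval tmax t -> A' t = A t /\ B' t = B t) ->
    Rbar_le T tmax.

(* Main.v *)
Require Import Defs.
From Stdlib Require Import Reals Lra Lia.
From Coquelicot Require Import Coquelicot.
Open Scope R_scope.

(** Write [z = A / B] for the anisotropy of the metric. Two pointwise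
    inequalities between the components of the vector field, together with local
    solvability of the equation, decide the fate of every solution, with no case
    distinction between oblate ([z < 1]) and prolate ([z > 1]) initial data.

    The sum [A + B] loses at least 7 per unit of time ([dA_plus_dB_le]): the
    terms without [alpha] add up to [- 4 (z - 1/2)^2 - 7], and the terms with
    [alpha] to [- alpha / B] times a positive polynomial in [z]. Since [A + B]
    stays positive, the lifetime [T] is finite. Moreover [A] decreases, so both
    [A] and [A + B] are monotone and bounded below, and hence
    [(A, B)] converges to some [(a, b)] with [a, b >= 0] as [t] tends to [T].

    If [b > 0], then [1 / A] has bounded derivative near [T], so that [a > 0]
    too ([limit_A_pos]): the limit lies in the open quarter plane. A local
    solution starting at [(a, b)] can then be appended ([solution_extends]),
    which contradicts maximality. Hence [b = 0].

    It remains to exclude [a > 0 = b], that is, [z] tending to infinity. For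
    large [z] the dominant terms give logarithmic derivatives
    [- 2 alpha z^2 / B^2] for [A] and [- 10 alpha z^2 / B^2] for [B], which
    suggests that [B] cannot decay faster than [A^5]. Indeed
    [B / A^5] is nondecreasing as soon as [A >= B] ([B_over_A5_rate_nonneg]), so [B] would
    stay above a positive multiple of [a^5] ([limit_A_nonpos]).

    The local solution comes from Picard iteration for a bounded Lipschitz field
    ([picard_lindelof]), applied to the field composed with the projection onto a
    compact box around [(a, b)]. The appended curve is differentiable at [T]
    because its derivative has a limit there ([is_derive_of_punctured]). *)

(** * Sequences with geometrically decreasing increments *)

Lemma nonpos_of_le_geometric (x K : R) :
  (forall n, x <= K * (1/2)^n) -> x <= 0.
Proof.
  intros h.
  apply (is_lim_seq_le (fun _ => x) (fun n => K * (1/2)^n) x 0 h).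
  - apply is_lim_seq_const.
  - replace (Finite 0) with (Rbar_mult K 0) by (simpl; f_equal; ring).
    apply is_lim_seq_scal_l, is_lim_seq_geom.
    rewrite Rabs_pos_eq; lra.
Qed.

Lemma half_pow_pos (n : nat) : 0 < (1/2)^n.
Proof. apply pow_lt; lra. Qed.

Lemma geometric_cauchy (w : nat -> R) (C : R) :
  (forall n, Rabs (w (S n) - w n) <= C * (1/2)^n) ->
  forall n, Rabs (w n - real (Lim_seq w)) <= 2 * C * (1/2)^n.
Proof.
  intros h.
  assert (tail : forall n k,
    Rabs (w (n + k)%nat - w n) <= 2 * C * ((1/2)^n - (1/2)^(n + k))).
  { intros n k; induction k as [|k IH].
    - rewrite Nat.add_0_r, Rminus_diag, Rabs_R0; lra.
    - rewrite Nat.add_succ_r; specialize (h (n + k)%nat).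
      replace (w (S (n + k)) - w n)
        with ((w (S (n + k)) - w (n + k)%nat) + (w (n + k)%nat - w n)) by ring.
      eapply Rle_trans; [apply Rabs_triang|].
      simpl; lra. }
  assert (C0 : 0 <= C).
  { specialize (h 0%nat); simpl in h.
    pose proof (Rabs_pos (w 1%nat - w 0%nat)); lra. }
  assert (tail' : forall n k, Rabs (w (n + k)%nat - w n) <= 2 * C * (1/2)^n).
  { intros n k; eapply Rle_trans; [apply tail|].
    apply Rmult_le_compat_l; [lra|].
    pose proof (half_pow_pos (n + k)); lra. }
  assert (cau : ex_finite_lim_seq w).
  { apply ex_lim_seq_cauchy_corr; intros eps.
    destruct (pow_lt_1_zero (1/2)) with (y := eps / (4 * C + 1)) as [N HN].
    - rewrite Rabs_pos_eq; lra.
    - apply Rdiv_lt_0_compat; [apply eps | lra].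
    - exists N; intros n m hn hm.
      specialize (HN N (Nat.le_refl N)).
      rewrite Rabs_pos_eq in HN by (left; apply half_pow_pos).
      apply (Rmult_lt_compat_r (4 * C + 1)) in HN; [|lra].
      unfold Rdiv in HN at 2.
      rewrite Rmult_assoc, Rinv_l, Rmult_1_r in HN by lra.
      pose proof (tail' N (n - N)%nat) as h1.
      pose proof (tail' N (m - N)%nat) as h2.
      replace (N + (n - N))%nat with n in h1 by lia.
      replace (N + (m - N))%nat with m in h2 by lia.
      replace (w n - w m) with ((w n - w N) - (w m - w N)) by ring.
      pose proof (half_pow_pos N).
      eapply Rle_lt_trans; [apply Rabs_triang|]; rewrite Rabs_Ropp.
      lra. }
  destruct cau as [l hl]; intros n.
  rewrite (is_lim_seq_unique w l hl); simpl real.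
  apply (is_lim_seq_le (fun k => Rabs (w n - w (k + n)%nat))
           (fun _ => 2 * C * (1/2)^n) (Rabs (w n - l)) (2 * C * (1/2)^n)).
  - intros k; rewrite Rabs_minus_sym, Nat.add_comm; apply tail'.
  - apply (is_lim_seq_abs _ (w n - l)), is_lim_seq_minus'.
    + apply is_lim_seq_const.
    + apply -> (is_lim_seq_incr_n w n l); exact hl.
  - apply is_lim_seq_const.
Qed.

(** * Bounded Lipschitz fields on the plane *)

Lemma lipschitz_continuous (f : R -> R) (K x : R) :
  (forall s t, Rabs (f t - f s) <= K * Rabs (t - s)) -> continuous f x.
Proof.
  intros h; apply filterlim_locally; intros eps.
  assert (d0 : 0 < eps / (Rabs K + 1)).
  { apply Rdiv_lt_0_compat; [apply eps | pose proof (Rabs_pos K); lra]. }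
  exists (mkposreal _ d0); intros y hy.
  change (Rabs (y - x) < eps / (Rabs K + 1)) in hy.
  change (Rabs (f y - f x) < eps).
  pose proof (Rabs_pos K) as K0.
  apply (Rmult_lt_compat_r (Rabs K + 1)) in hy; [|lra].
  unfold Rdiv in hy; rewrite Rmult_assoc, Rinv_l, Rmult_1_r in hy by lra.
  eapply Rle_lt_trans; [apply h|].
  pose proof (Rle_abs K); pose proof (Rabs_pos (y - x)); nra.
Qed.

(** The nearest-point projection onto [[lo, hi]]. Composing a field with it makes
    the field globally bounded and Lipschitz without changing it on a box. *)
Definition clamp (lo hi x : R) : R := Rmax lo (Rmin hi x).

Lemma clamp_bounds (lo hi x : R) : lo <= hi -> lo <= clamp lo hi x <= hi.
Proof.
  intros h; unfold clamp, Rmax, Rmin.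
  destruct (Rle_dec hi x), (Rle_dec _ _); lra.
Qed.

Lemma clamp_id (lo hi x : R) : lo <= x <= hi -> clamp lo hi x = x.
Proof.
  intros h; unfold clamp, Rmax, Rmin.
  destruct (Rle_dec hi x), (Rle_dec _ _); lra.
Qed.

Lemma clamp_lipschitz (lo hi x y : R) :
  Rabs (clamp lo hi x - clamp lo hi y) <= Rabs (x - y).
Proof.
  unfold clamp, Rmax, Rmin.
  destruct (Rle_dec hi x), (Rle_dec hi y); repeat destruct (Rle_dec _ _);
    unfold Rabs; repeat destruct (Rcase_abs _); lra.
Qed.

(** One constant serves as the bound and as the Lipschitz constant: closure under
    products, and so the treatment of rational fields, needs both at once. *)
Definition bounded_lipschitz (f : R -> R -> R) : Prop :=
  exists K, 0 <= K /\ forall a b a' b',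
    Rabs (f a b) <= K /\
    Rabs (f a b - f a' b') <= K * (Rabs (a - a') + Rabs (b - b')).

Lemma bounded_lipschitz_weaken (f : R -> R -> R) (K K' : R) :
  K <= K' ->
  (forall a b a' b', Rabs (f a b) <= K /\
    Rabs (f a b - f a' b') <= K * (Rabs (a - a') + Rabs (b - b'))) ->
  forall a b a' b', Rabs (f a b) <= K' /\
    Rabs (f a b - f a' b') <= K' * (Rabs (a - a') + Rabs (b - b')).
Proof.
  intros hK h a b a' b'; destruct (h a b a' b') as [h1 h2]; split; [lra|].
  pose proof (Rabs_pos (a - a')); pose proof (Rabs_pos (b - b')); nra.
Qed.

Lemma bounded_lipschitz_const (c : R) : bounded_lipschitz (fun _ _ => c).
Proof.
  exists (Rabs c); split; [apply Rabs_pos|]; intros a b a' b'.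
  split; [lra|]; rewrite Rminus_diag, Rabs_R0.
  apply Rmult_le_pos; [apply Rabs_pos|].
  apply Rplus_le_le_0_compat; apply Rabs_pos.
Qed.

Lemma bounded_lipschitz_plus (f g : R -> R -> R) :
  bounded_lipschitz f -> bounded_lipschitz g ->
  bounded_lipschitz (fun a b => f a b + g a b).
Proof.
  intros [K [K0 hf]] [M [M0 hg]]; exists (K + M); split; [lra|].
  intros a b a' b'.
  destruct (hf a b a' b') as [f1 f2], (hg a b a' b') as [g1 g2]; split.
  - eapply Rle_trans; [apply Rabs_triang|]; lra.
  - replace (f a b + g a b - (f a' b' + g a' b'))
      with ((f a b - f a' b') + (g a b - g a' b')) by ring.
    eapply Rle_trans; [apply Rabs_triang|]; lra.
Qed.

Lemma bounded_lipschitz_mult (f g : R -> R -> R) :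
  bounded_lipschitz f -> bounded_lipschitz g ->
  bounded_lipschitz (fun a b => f a b * g a b).
Proof.
  intros [K [K0 hf]] [M [M0 hg]].
  exists (2 * (K * M)); split; [nra|]; intros a b a' b'.
  destruct (hf a b a' b') as [f1 f2], (hg a b a' b') as [_ g2].
  destruct (hg a' b' a b) as [g1 _], (hg a b a b) as [g3 _].
  pose proof (Rabs_pos (f a b)); pose proof (Rabs_pos (g a' b')).
  pose proof (Rabs_pos (g a b)).
  split.
  - rewrite Rabs_mult.
    assert (Rabs (f a b) * Rabs (g a b) <= K * M)
      by (apply Rmult_le_compat; lra).
    nra.
  - replace (f a b * g a b - f a' b' * g a' b')
      with (f a b * (g a b - g a' b') + (f a b - f a' b') * g a' b') by ring.
    eapply Rle_trans; [apply Rabs_triang|]; rewrite !Rabs_mult.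
    pose proof (Rabs_pos (g a b - g a' b')).
    pose proof (Rabs_pos (f a b - f a' b')).
    assert (Rabs (f a b) * Rabs (g a b - g a' b')
            <= K * (M * (Rabs (a - a') + Rabs (b - b'))))
      by (apply Rmult_le_compat; lra).
    assert (Rabs (f a b - f a' b') * Rabs (g a' b')
            <= K * (Rabs (a - a') + Rabs (b - b')) * M)
      by (apply Rmult_le_compat; lra).
    lra.
Qed.

Lemma bounded_lipschitz_pow (f : R -> R -> R) (n : nat) :
  bounded_lipschitz f -> bounded_lipschitz (fun a b => f a b ^ n).
Proof.
  intros hf; induction n as [|n IH]; simpl.
  - apply bounded_lipschitz_const.
  - apply bounded_lipschitz_mult; assumption.
Qed.

Lemma bounded_lipschitz_swap (f : R -> R -> R) :
  bounded_lipschitz f -> bounded_lipschitz (fun a b => f b a).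
Proof.
  intros [K [K0 hf]]; exists K; split; [exact K0|]; intros a b a' b'.
  destruct (hf b a b' a') as [f1 f2]; split; lra.
Qed.

Lemma bounded_lipschitz_clamp (lo hi : R) :
  lo <= hi -> bounded_lipschitz (fun a _ => clamp lo hi a).
Proof.
  intros h; pose proof (Rabs_pos lo); pose proof (Rabs_pos hi).
  exists (Rabs lo + Rabs hi + 1); split; [lra|]; intros a b a' b'; split.
  - destruct (clamp_bounds lo hi a h).
    pose proof (Rle_abs hi); pose proof (Rle_abs (- lo)).
    rewrite Rabs_Ropp in *; apply Rabs_le; lra.
  - pose proof (clamp_lipschitz lo hi a a').
    pose proof (Rabs_pos (a - a')); pose proof (Rabs_pos (b - b')); nra.
Qed.

Lemma bounded_lipschitz_inv (f : R -> R -> R) (m : R) :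
  0 < m -> (forall a b, m <= f a b) -> bounded_lipschitz f ->
  bounded_lipschitz (fun a b => / f a b).
Proof.
  intros m0 hm [K [K0 hf]].
  assert (i0 : 0 < / m) by (apply Rinv_0_lt_compat, m0).
  assert (hi : forall a b, 0 <= / f a b <= / m).
  { intros a b; split.
    - left; apply Rinv_0_lt_compat; specialize (hm a b); lra.
    - apply Rinv_le_contravar; [exact m0 | apply hm]. }
  exists (/ m + K * (/ m * / m)); split; [nra|]; intros a b a' b'.
  assert (0 <= K * (/ m * / m)) by nra.
  split.
  - rewrite Rabs_pos_eq by apply hi; destruct (hi a b); lra.
  - assert (f a b <> 0) by (specialize (hm a b); lra).
    assert (f a' b' <> 0) by (specialize (hm a' b'); lra).
    replace (/ f a b - / f a' b')
      with (- (f a b - f a' b') * (/ f a b * / f a' b')) by (field; auto).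
    rewrite Rabs_mult, Rabs_Ropp.
    destruct (hf a b a' b') as [_ f2], (hi a b), (hi a' b').
    rewrite (Rabs_pos_eq (/ f a b * / f a' b')) by nra.
    pose proof (Rabs_pos (f a b - f a' b')).
    pose proof (Rabs_pos (a - a')); pose proof (Rabs_pos (b - b')).
    assert (/ f a b * / f a' b' <= / m * / m)
      by (apply Rmult_le_compat; lra).
    assert (Rabs (f a b - f a' b') * (/ f a b * / f a' b') <=
            K * (Rabs (a - a') + Rabs (b - b')) * (/ m * / m))
      by (apply Rmult_le_compat; nra).
    nra.
Qed.

Lemma bounded_lipschitz_ext (f g : R -> R -> R) :
  (forall a b, f a b = g a b) -> bounded_lipschitz f -> bounded_lipschitz g.
Proof.
  intros e [K [K0 hf]]; exists K; split; [exact K0|].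
  intros a b a' b'; rewrite <- !e; apply hf.
Qed.

(** * Picard iteration *)

(** Time is clamped to [[- d, d]] so that every Picard iterate is defined,
    continuous and Lipschitz on the whole line; the estimates below then need no
    restriction on [t], and [integral_from] is still an antiderivative inside the
    interval. *)
Definition integral_from (a d : R) (h : R -> R) (t : R) : R :=
  a + RInt h 0 (clamp (- d) d t).

Lemma ex_RInt_of_continuous (h : R -> R) (p q : R) :
  (forall x, continuous h x) -> ex_RInt h p q.
Proof.
  intros hc; apply (ex_RInt_continuous (V := R_CompleteNormedModule)); auto.
Qed.

Lemma abs_RInt_le (h : R -> R) (M p q : R) :
  (forall x, continuous h x) -> (forall x, Rabs (h x) <= M) ->
  Rabs (RInt h p q) <= M * Rabs (q - p).
Proof.
  intros hc hM; destruct (Rle_dec p q) as [hpq|hpq].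
  - rewrite (Rabs_pos_eq (q - p)) by lra; rewrite Rmult_comm.
    apply abs_RInt_le_const; auto using ex_RInt_of_continuous.
  - rewrite <- (opp_RInt_swap h q p) by auto using ex_RInt_of_continuous.
    change opp with Ropp; rewrite Rabs_Ropp, (Rabs_minus_sym q p).
    rewrite (Rabs_pos_eq (p - q)), Rmult_comm by lra.
    apply abs_RInt_le_const; auto using ex_RInt_of_continuous; lra.
Qed.

Lemma integral_from_lipschitz (a d M : R) (h : R -> R) (s t : R) :
  0 <= M -> (forall x, continuous h x) -> (forall x, Rabs (h x) <= M) ->
  Rabs (integral_from a d h t - integral_from a d h s) <= M * Rabs (t - s).
Proof.
  intros M0 hc hM; unfold integral_from.
  rewrite <- (RInt_Chasles h 0 (clamp (- d) d s) (clamp (- d) d t))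
    by auto using ex_RInt_of_continuous.
  change plus with Rplus.
  assert (cancel : forall x y, a + (x + y) - (a + x) = y) by (intros; ring).
  rewrite cancel.
  eapply Rle_trans; [apply abs_RInt_le; eassumption|].
  apply Rmult_le_compat_l; [exact M0 | apply clamp_lipschitz].
Qed.

Lemma integral_from_near (a d e : R) (h k : R -> R) (t : R) :
  0 <= d ->
  (forall x, continuous h x) -> (forall x, continuous k x) ->
  (forall x, Rabs (h x - k x) <= e) ->
  Rabs (integral_from a d h t - integral_from a d k t) <= d * e.
Proof.
  intros d0 hc kc hk; unfold integral_from.
  replace (a + RInt h 0 (clamp (- d) d t) - (a + RInt k 0 (clamp (- d) d t)))
    with (RInt h 0 (clamp (- d) d t) - RInt k 0 (clamp (- d) d t)) by ring.
  change Rminus with (@minus R_AbelianGroup).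
  rewrite <- (RInt_minus h k) by auto using ex_RInt_of_continuous.
  change (@minus R_AbelianGroup) with Rminus.
  eapply Rle_trans.
  - apply abs_RInt_le; [|exact hk].
    intros x; apply (continuous_minus h k); auto.
  - rewrite Rmult_comm; apply Rmult_le_compat_r.
    + eapply Rle_trans; [apply Rabs_pos | apply (hk 0)].
    + rewrite Rminus_0_r; apply Rabs_le, clamp_bounds; lra.
Qed.

Lemma integral_from_derive (a d : R) (h : R -> R) (t : R) :
  - d < t < d -> (forall x, continuous h x) ->
  is_derive (integral_from a d h) t (h t).
Proof.
  intros ht hc.
  apply (is_derive_ext_loc (fun s => a + RInt h 0 s)).
  - apply (locally_interval _ t (- d) d); simpl; try tauto.
    intros y h1 h2; unfold integral_from; rewrite clamp_id; [reflexivity | lra].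
  - replace (h t) with (0 + h t) by ring.
    apply (is_derive_plus (fun _ => a) (fun s => RInt h 0 s)).
    + apply @is_derive_const.
    + apply (is_derive_RInt h _ 0); [|apply hc].
      apply filter_forall; intros x.
      apply (RInt_correct h), ex_RInt_of_continuous, hc.
Qed.

Fixpoint picard (F G : R -> R -> R) (a b d : R) (n : nat)
    : (R -> R) * (R -> R) :=
  match n with
  | O => (fun _ => a, fun _ => b)
  | S m =>
      let p := picard F G a b d m in
      (integral_from a d (fun s => F (fst p s) (snd p s)),
       integral_from b d (fun s => G (fst p s) (snd p s)))
  end.

Definition lipschitz (K : R) (f : R -> R) : Prop :=
  forall s t, Rabs (f t - f s) <= K * Rabs (t - s).

(** All iterates are [K]-Lipschitz because the fields are bounded by [K], so the
    integrands are continuous and the limits inherit the Lipschitz bound. On an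
    interval of radius [d = 1 / (4 K)] the Picard operator halves the distance
    [|p - p'| + |q - q'|], so the iterates converge uniformly and geometrically,
    and the limit is a fixed point. *)
Lemma picard_lindelof (F G : R -> R -> R) (a b : R) :
  bounded_lipschitz F -> bounded_lipschitz G ->
  exists (d : R) (u v : R -> R), 0 < d /\ u 0 = a /\ v 0 = b /\
    (forall t, continuous u t /\ continuous v t) /\
    forall t, - d < t < d ->
      is_derive u t (F (u t) (v t)) /\ is_derive v t (G (u t) (v t)).
Proof.
  intros [K1 [K10 hF1]] [K2 [K20 hG1]].
  set (K := K1 + K2 + 1).
  assert (K0 : 1 <= K) by (unfold K; lra).
  pose proof (bounded_lipschitz_weaken F K1 K ltac:(unfold K; lra) hF1) as hF.
  pose proof (bounded_lipschitz_weaken G K2 K ltac:(unfold K; lra) hG1) as hG.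
  clearbody K; clear K1 K2 K10 K20 hF1 hG1.
  set (d := / (4 * K)).
  assert (d0 : 0 < d) by (apply Rinv_0_lt_compat; lra).
  assert (dK : d * K = 1/4) by (unfold d; field; lra).
  assert (comp : forall (H : R -> R -> R) (p q : R -> R),
    (forall a b a' b', Rabs (H a b) <= K /\
      Rabs (H a b - H a' b') <= K * (Rabs (a - a') + Rabs (b - b'))) ->
    lipschitz K p -> lipschitz K q ->
    forall x, continuous (fun s => H (p s) (q s)) x).
  { intros H p q hH hp hq x.
    apply (lipschitz_continuous _ (K * (2 * K))); intros s t.
    destruct (hH (p t) (q t) (p s) (q s)) as [_ h2].
    eapply Rle_trans; [apply h2|]; rewrite Rmult_assoc.
    apply Rmult_le_compat_l; [lra|].
    pose proof (hp s t); pose proof (hq s t); lra. }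
  set (u := fun n => fst (picard F G a b d n)).
  set (v := fun n => snd (picard F G a b d n)).
  assert (lip : forall n, lipschitz K (u n) /\ lipschitz K (v n)).
  { induction n as [|n [IHu IHv]].
    - split; intros s t; simpl; rewrite Rminus_diag, Rabs_R0;
        apply Rmult_le_pos; try apply Rabs_pos; lra.
    - split; intros s t.
      + apply integral_from_lipschitz; [lra | apply (comp F); auto |].
        intros x; apply (hF _ _ 0 0).
      + apply integral_from_lipschitz; [lra | apply (comp G); auto |].
        intros x; apply (hG _ _ 0 0). }
  assert (step : forall (p q p' q' : R -> R) (e : R),
    lipschitz K p -> lipschitz K q -> lipschitz K p' -> lipschitz K q' ->
    (forall x, Rabs (p x - p' x) + Rabs (q x - q' x) <= e) -> forall t,
    Rabs (integral_from a d (fun s => F (p s) (q s)) t -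
          integral_from a d (fun s => F (p' s) (q' s)) t) <= 1/4 * e /\
    Rabs (integral_from b d (fun s => G (p s) (q s)) t -
          integral_from b d (fun s => G (p' s) (q' s)) t) <= 1/4 * e).
  { intros p q p' q' e hp hq hp' hq' he t.
    rewrite <- dK, Rmult_assoc.
    split; apply integral_from_near; auto; try lra; intros x.
    - destruct (hF (p x) (q x) (p' x) (q' x)) as [_ h2].
      eapply Rle_trans; [apply h2|]; apply Rmult_le_compat_l; [lra | apply he].
    - destruct (hG (p x) (q x) (p' x) (q' x)) as [_ h2].
      eapply Rle_trans; [apply h2|]; apply Rmult_le_compat_l; [lra | apply he]. }
  (* The first increment is at most [d * K = 1/4], below the claimed [1/2]. *)
  assert (succ : forall n t, Rabs (u (S n) t - u n t) <= 1/2 * (1/2)^n /\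
                             Rabs (v (S n) t - v n t) <= 1/2 * (1/2)^n).
  { induction n as [|n IH]; intros t.
    - assert (base : forall (c : R) (h : R -> R),
        (forall x, continuous h x) -> (forall x, Rabs (h x) <= K) ->
        Rabs (integral_from c d h t - c) <= 1/2 * (1/2)^0).
      { intros c h hc hK; unfold integral_from.
        rewrite Rplus_minus_l.
        eapply Rle_trans; [apply abs_RInt_le; eassumption|].
        rewrite Rminus_0_r.
        assert (Rabs (clamp (- d) d t) <= d)
          by (apply Rabs_le, clamp_bounds; lra).
        simpl; nra. }
      split; apply base.
      + apply (comp F); [apply hF | apply (lip 0%nat) | apply (lip 0%nat)].
      + intros x; apply (hF _ _ 0 0).
      + apply (comp G); [apply hG | apply (lip 0%nat) | apply (lip 0%nat)].
      + intros x; apply (hG _ _ 0 0).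
    - replace (1/2 * (1/2)^(S n)) with (1/4 * (1/2)^n) by (simpl; field).
      apply (step (u (S n)) (v (S n)) (u n) (v n)); try apply lip.
      intros x; destruct (IH x); lra. }
  set (U := fun t => real (Lim_seq (fun n => u n t))).
  assert (hU : forall t n, Rabs (u n t - U t) <= 2 * (1/2) * (1/2)^n).
  { intros t; apply geometric_cauchy; intros m; apply succ. }
  set (V := fun t => real (Lim_seq (fun n => v n t))).
  assert (hV : forall t n, Rabs (v n t - V t) <= 2 * (1/2) * (1/2)^n).
  { intros t; apply geometric_cauchy; intros m; apply succ. }
  clearbody U V.
  assert (limlip : forall (w : nat -> R -> R) (W : R -> R),
    (forall n, lipschitz K (w n)) ->
    (forall t n, Rabs (w n t - W t) <= 2 * (1/2) * (1/2)^n) -> lipschitz K W).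
  { intros w W hw hW s t; apply Rminus_le.
    apply (nonpos_of_le_geometric _ 2); intros n.
    pose proof (hw n s t); pose proof (hW s n) as h1; pose proof (hW t n) as h2.
    rewrite Rabs_minus_sym in h2.
    replace (W t - W s)
      with ((W t - w n t) + ((w n t - w n s) + (w n s - W s))) by ring.
    pose proof (Rabs_triang (W t - w n t) ((w n t - w n s) + (w n s - W s))).
    pose proof (Rabs_triang (w n t - w n s) (w n s - W s)).
    lra. }
  assert (lU : lipschitz K U) by (apply (limlip u); [apply lip | exact hU]).
  assert (lV : lipschitz K V) by (apply (limlip v); [apply lip | exact hV]).
  (* The [n]-th iterate is within [(1/2)^n] of the limit in each component, so
     its image under the Picard operator, which is the next iterate, is within
     [(1/2)^n / 2] of the image of the limit. *)
  assert (fixed : forall t,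
    U t = integral_from a d (fun s => F (U s) (V s)) t /\
    V t = integral_from b d (fun s => G (U s) (V s)) t).
  { intros t.
    assert (near : forall n,
      Rabs (U t - integral_from a d (fun s => F (U s) (V s)) t) <= 1 * (1/2)^n /\
      Rabs (V t - integral_from b d (fun s => G (U s) (V s)) t) <= 1 * (1/2)^n).
    { intros n.
      destruct (step (u n) (v n) U V (2 * (1/2)^n)) with (t := t) as [s1 s2];
        try apply lip; auto.
      { intros x; specialize (hU x n); specialize (hV x n); lra. }
      pose proof (hU t (S n)) as h1; pose proof (hV t (S n)) as h2.
      change (u (S n) t)
        with (integral_from a d (fun s => F (u n s) (v n s)) t) in h1.
      change (v (S n) t)
        with (integral_from b d (fun s => G (u n s) (v n s)) t) in h2.
      simpl pow in h1, h2; rewrite Rabs_minus_sym in h1, h2.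
      split; (match goal with |- Rabs (?x - ?z) <= _ =>
        match goal with h : Rabs (x - ?y) <= _ |- _ =>
          replace (x - z) with ((x - y) + (y - z)) by ring end end;
        eapply Rle_trans; [apply Rabs_triang|]; lra). }
    split; apply Rminus_diag_uniq, Rabs_eq_0, Rle_antisym;
      try apply Rabs_pos; apply (nonpos_of_le_geometric _ 1); apply near. }
  assert (at0 : forall c h, integral_from c d h 0 = c).
  { intros c h; unfold integral_from; rewrite clamp_id, RInt_point by lra.
    apply Rplus_0_r. }
  exists d, U, V; split; [exact d0|]; split; [|split; [|split]].
  - rewrite (proj1 (fixed 0)); apply at0.
  - rewrite (proj2 (fixed 0)); apply at0.
  - intros t; split; apply (lipschitz_continuous _ K); assumption.
  - intros t ht; split.
    + apply (is_derive_ext (integral_from a d (fun s => F (U s) (V s)))).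
      * intros s; symmetry; apply fixed.
      * apply (integral_from_derive a d (fun s => F (U s) (V s)) t ht).
        apply (comp F); auto.
    + apply (is_derive_ext (integral_from b d (fun s => G (U s) (V s)))).
      * intros s; symmetry; apply fixed.
      * apply (integral_from_derive b d (fun s => G (U s) (V s)) t ht).
        apply (comp G); auto.
Qed.

(** * Appending a curve at the end of another *)

Lemma continuous_comp_bounded_lipschitz
    (F : R -> R -> R) (p q : R -> R) (x : R) :
  bounded_lipschitz F -> continuous p x -> continuous q x ->
  continuous (fun s => F (p s) (q s)) x.
Proof.
  intros [K [K0 hF]] hp hq; apply filterlim_locally; intros eps.
  assert (e0 : 0 < eps / (2 * K + 1)).
  { apply Rdiv_lt_0_compat; [apply eps | lra]. }
  apply (proj1 (filterlim_locally _ _)) with (eps := mkposreal _ e0) in hp.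
  apply (proj1 (filterlim_locally _ _)) with (eps := mkposreal _ e0) in hq.
  generalize (filter_and _ _ hp hq); apply filter_imp; intros y [h1 h2].
  change (Rabs (p y - p x) < eps / (2 * K + 1)) in h1.
  change (Rabs (q y - q x) < eps / (2 * K + 1)) in h2.
  change (Rabs (F (p y) (q y) - F (p x) (q x)) < eps).
  destruct (hF (p y) (q y) (p x) (q x)) as [_ h3].
  set (e := eps / (2 * K + 1)) in *.
  assert (he : (2 * K + 1) * e = eps) by (unfold e; field; lra).
  nra.
Qed.

(** By the mean value theorem each difference quotient at [x] equals [g c] for
    some [c] between [x] and [x + h], and [g] is continuous at [x]. *)
Lemma is_derive_of_punctured (f g : R -> R) (x : R) :
  continuous f x -> continuous g x ->
  locally' x (fun s => is_derive f s (g s)) -> is_derive f x (g x).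
Proof.
  intros hf hg [r hr].
  apply is_derive_Reals; intros eps eps0.
  apply (proj1 (filterlim_locally _ _)) with (eps := mkposreal _ eps0) in hg.
  destruct hg as [r' hr'].
  assert (m0 : 0 < Rmin r r') by (apply Rmin_pos; [apply r | apply r']).
  exists (mkposreal _ m0); intros h h0 hh; simpl in hh.
  pose proof (Rmin_l r r'); pose proof (Rmin_r r r').
  assert (near : forall s, Rmin x (x + h) <= s <= Rmax x (x + h) ->
                 Rabs (s - x) < Rmin r r').
  { intros s; apply Rabs_lt_between in hh.
    unfold Rmin at 1, Rmax; destruct (Rle_dec _ _); intros hs;
      apply Rabs_lt_between; lra. }
  assert (der : forall s, Rmin x (x + h) <= s <= Rmax x (x + h) -> s <> x ->
                is_derive f s (g s)).
  { intros s hs hsx; apply hr; [|exact hsx].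
    change (Rabs (s - x) < r); specialize (near s hs); lra. }
  destruct (MVT_gen f x (x + h) g) as [c [hc e]].
  - intros s hs; apply der; [lra|].
    intros ->; unfold Rmin, Rmax in hs; destruct (Rle_dec _ _); lra.
  - intros s hs; apply continuity_pt_filterlim.
    destruct (Req_dec s x) as [->|hsx]; [exact hf|].
    apply (ex_derive_continuous (V := R_NormedModule) f).
    exists (g s); apply der; assumption.
  - rewrite e; replace (g c * (x + h - x) / h) with (g c) by (field; exact h0).
    apply hr'; change (Rabs (c - x) < r'); specialize (near c hc); lra.
Qed.

Definition glue (f g : R -> R) (T t : R) : R :=
  if Rlt_dec t T then f t else g (t - T).

Lemma glue_left (f g : R -> R) (T t : R) : t < T -> glue f g T t = f t.
Proof. intros h; unfold glue; destruct (Rlt_dec t T); [reflexivity | lra]. Qed.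

Lemma glue_right (f g : R -> R) (T t : R) : T <= t -> glue f g T t = g (t - T).
Proof. intros h; unfold glue; destruct (Rlt_dec t T); [lra | reflexivity]. Qed.

Lemma glue_continuous (f g : R -> R) (T : R) :
  filterlim f (at_left T) (locally (g 0)) -> continuous g 0 ->
  continuous (glue f g T) T.
Proof.
  intros hf hg; unfold continuous; rewrite glue_right, Rminus_diag by lra.
  apply filterlim_locally; intros eps.
  destruct (proj1 (filterlim_locally _ _) hf eps) as [r hr].
  destruct (proj1 (filterlim_locally _ _) hg eps) as [r' hr'].
  assert (m0 : 0 < Rmin r r') by (apply Rmin_pos; [apply r | apply r']).
  pose proof (Rmin_l r r'); pose proof (Rmin_r r r').
  exists (mkposreal _ m0); intros t ht.
  change (Rabs (t - T) < Rmin r r') in ht.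
  destruct (Rlt_le_dec t T) as [h|h].
  - rewrite glue_left by exact h; apply hr; [|exact h].
    change (Rabs (t - T) < r); lra.
  - rewrite glue_right by exact h; apply hr'.
    change (Rabs (t - T - 0) < r'); rewrite Rminus_0_r; lra.
Qed.

(** The field [F] sees both curves but only the first one is differentiated, so
    that the lemma also serves for the second component, with the roles of the
    components exchanged. *)
Lemma glue_derive (F : R -> R -> R) (A B u v : R -> R) (T e : R) :
  bounded_lipschitz F ->
  filterlim A (at_left T) (locally (u 0)) ->
  filterlim B (at_left T) (locally (v 0)) ->
  continuous u 0 -> continuous v 0 ->
  (forall t, T - e < t < T -> is_derive A t (F (A t) (B t))) ->
  (forall t, 0 < t < e -> is_derive u t (F (u t) (v t))) ->
  forall t, T - e < t < T + e ->
    is_derive (glue A u T) t (F (glue A u T t) (glue B v T t)).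
Proof.
  intros hF hA hB hu hv dA du.
  assert (off : forall t, T - e < t < T + e -> t <> T ->
    is_derive (glue A u T) t (F (glue A u T t) (glue B v T t))).
  { intros t ht hne; destruct (Rlt_le_dec t T) as [h|h].
    - rewrite !glue_left by exact h.
      apply (is_derive_ext_loc A); [|apply dA; lra].
      apply (locally_interval _ t m_infty T); simpl; try tauto.
      intros s _ hs; symmetry; apply glue_left, hs.
    - rewrite !glue_right by exact h.
      apply (is_derive_ext_loc (fun s => u (s - T))).
      + apply (locally_interval _ t T p_infty); simpl; try tauto; [lra|].
        intros s hs _; symmetry; apply glue_right; lra.
      + replace (F (u (t - T)) (v (t - T)))
          with (scal 1 (F (u (t - T)) (v (t - T)))) by apply Rmult_1_l.
        apply (is_derive_comp u (fun s => s - T)).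
        * apply du; lra.
        * auto_derive; [exact I | ring]. }
  intros t ht; destruct (Req_dec t T) as [->|hne]; [|apply off; assumption].
  apply (is_derive_of_punctured _ (fun s => F (glue A u T s) (glue B v T s))).
  - apply glue_continuous; assumption.
  - apply continuous_comp_bounded_lipschitz; [exact hF| |];
      apply glue_continuous; assumption.
  - apply (locally_interval _ T (T - e) (T + e)); simpl; try lra.
    intros s h1 h2 hs; apply off; [lra | exact hs].
Qed.

(** * Extending solutions inside the open quarter plane *)

(** Derivatives relative to a domain depend only on the values and the domain
    near the point, and pass to smaller domains. This restricts two-sided
    derivatives to a forward interval, recovers them at interior points, and
    covers the one-sided derivative at time 0 of an extended solution. *)
Lemma D_in_local (f g d d' : R -> R) (D D' : R -> Prop) (t r : R) :
  0 < r -> f t = g t -> d t = d' t ->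
  (forall s, Rabs (s - t) < r -> D' s -> D s /\ f s = g s) ->
  D_in f d D t -> D_in g d' D' t.
Proof.
  intros r0 ft dt loc h eps eps0.
  destruct (h eps eps0) as [a [a0 ha]].
  exists (Rmin a r); split; [apply Rmin_pos; assumption|].
  pose proof (Rmin_l a r); pose proof (Rmin_r a r).
  intros s [[Ds hne] hs]; simpl in hs; unfold Rdist in hs.
  destruct (loc s ltac:(lra) Ds) as [D's e].
  rewrite <- ft, <- dt, <- e; apply ha.
  split; [split; assumption|]; simpl; unfold Rdist; lra.
Qed.

Lemma D_in_of_is_derive (f d : R -> R) (D : R -> Prop) (t : R) :
  is_derive f t (d t) -> D_in f d D t.
Proof.
  intros h; apply (D_in_local f f d d no_cond D t 1); auto; [lra | |].
  - intros s _ _; split; [exact I | reflexivity].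
  - apply derivable_pt_lim_D_in, is_derive_Reals, h.
Qed.

Lemma forward_interval_open (T : Rbar) (t : R) :
  0 < t -> Rbar_lt t T ->
  exists r, 0 < r /\ forall s, Rabs (s - t) < r -> forward_interval T s.
Proof.
  intros t0 tT; destruct T as [T| |]; simpl in tT; [| |tauto].
  - exists (Rmin t (T - t)); split; [apply Rmin_pos; lra|].
    pose proof (Rmin_l t (T - t)); pose proof (Rmin_r t (T - t)).
    intros s hs; apply Rabs_lt_between in hs; split; simpl; lra.
  - exists t; split; [exact t0|].
    intros s hs; apply Rabs_lt_between in hs; split; simpl; [lra | exact I].
Qed.

Lemma solution_derive (alpha : R) (T : Rbar) (A B : R -> R) (t : R) :
  is_solution alpha T A B -> 0 < t -> Rbar_lt t T ->
  0 < A t /\ 0 < B t /\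
  is_derive A t (dA_dt alpha (A t) (B t)) /\
  is_derive B t (dB_dt alpha (A t) (B t)).
Proof.
  intros [_ h] t0 tT.
  destruct (forward_interval_open T t t0 tT) as [r [r0 hr]].
  destruct (h t) as [pA [pB [dA dB]]]; [split; [lra | exact tT]|].
  assert (two_sided : forall f d, D_in f d (forward_interval T) t ->
                      is_derive f t (d t)).
  { intros f d hd; apply is_derive_Reals, derivable_pt_lim_D_in.
    revert hd; apply (D_in_local f f d d _ _ t r); auto. }
  split; [exact pA|]; split; [exact pB|]; split.
  - apply (two_sided A _ dA).
  - apply (two_sided B _ dB).
Qed.

Lemma clamped_fields_bounded_lipschitz (alpha lo hi : R) :
  0 < lo <= hi ->
  bounded_lipschitz (fun a b => dA_dt alpha (clamp lo hi a) (clamp lo hi b)) /\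
  bounded_lipschitz (fun a b => dB_dt alpha (clamp lo hi a) (clamp lo hi b)).
Proof.
  intros [lo0 h].
  pose proof (bounded_lipschitz_clamp lo hi h) as ha.
  pose proof (bounded_lipschitz_swap _ ha) as hb; simpl in hb.
  pose proof (bounded_lipschitz_inv _ lo lo0
    (fun a b => proj1 (clamp_bounds lo hi b h)) hb) as hi'; simpl in hi'.
  assert (ne : forall b, clamp lo hi b <> 0).
  { intros b; destruct (clamp_bounds lo hi b h); lra. }
  split.
  - apply (bounded_lipschitz_ext (fun a b =>
      (-4 * (clamp lo hi a ^ 2 * clamp lo hi b ^ 2)
       + (-2 * alpha) * clamp lo hi a ^ 3) * (/ clamp lo hi b) ^ 4)).
    { intros a b; unfold dA_dt; field; apply ne. }
    repeat first [ apply bounded_lipschitz_mult | apply bounded_lipschitz_plus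
                 | apply bounded_lipschitz_pow | apply bounded_lipschitz_const
                 | assumption ].
  - apply (bounded_lipschitz_ext (fun a b =>
      (4 * (clamp lo hi a * clamp lo hi b ^ 2) + (-8) * clamp lo hi b ^ 3
       + (-10 * alpha) * clamp lo hi a ^ 2 + (-16 * alpha) * clamp lo hi b ^ 2
       + 24 * alpha * (clamp lo hi a * clamp lo hi b))
      * (/ clamp lo hi b) ^ 3)).
    { intros a b; unfold dB_dt; field; apply ne. }
    repeat first [ apply bounded_lipschitz_mult | apply bounded_lipschitz_plus
                 | apply bounded_lipschitz_pow | apply bounded_lipschitz_const
                 | assumption ].
Qed.

Lemma eventually_between (F : (R -> Prop) -> Prop) {FF : Filter F}
    (f : R -> R) (l lo hi : R) :
  filterlim f F (locally l) -> lo < l < hi -> F (fun t => lo <= f t <= hi).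
Proof.
  intros hf hl; apply (hf (fun y => lo <= y <= hi)).
  apply (locally_interval _ l lo hi); simpl; try lra.
  intros y; lra.
Qed.

(** The limit point lies in the interior of the square [[lo, hi]^2], on which the
    clamped field is the original one. Both the given solution just before [T]
    and the appended one just after it stay in that square. *)
Lemma solution_extends (alpha T : R) (A B : R -> R) (a b : R) :
  is_solution alpha T A B -> 0 < a -> 0 < b ->
  filterlim A (at_left T) (locally a) -> filterlim B (at_left T) (locally b) ->
  exists (T' : R) (A' B' : R -> R), T < T' /\ is_solution alpha T' A' B' /\
    forall t, forward_interval T t -> A' t = A t /\ B' t = B t.
Proof.
  intros sol a0 b0 hA hB.
  assert (T0 : 0 < T) by (destruct sol as [h _]; exact h).
  set (lo := Rmin a b / 2); set (hi := a + b).
  assert (lo0 : 0 < lo)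
    by (pose proof (Rmin_pos a b a0 b0); unfold lo; lra).
  assert (la : lo < a < hi)
    by (pose proof (Rmin_l a b); unfold lo, hi in *; lra).
  assert (lb : lo < b < hi)
    by (pose proof (Rmin_r a b); unfold lo, hi in *; lra).
  destruct (clamped_fields_bounded_lipschitz alpha lo hi) as [FL GL]; [lra|].
  destruct (picard_lindelof _ _ a b FL GL)
    as [d [u [v [d0 [u0 [v0 [cuv duv]]]]]]].
  destruct (eventually_between (locally 0) u a lo hi) as [e1 h1];
    [rewrite <- u0; apply cuv | exact la |].
  destruct (eventually_between (locally 0) v b lo hi) as [e2 h2];
    [rewrite <- v0; apply cuv | exact lb |].
  destruct (eventually_between _ A a lo hi hA la) as [e3 h3].
  destruct (eventually_between _ B b lo hi hB lb) as [e4 h4].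
  set (e := Rmin (Rmin T d) (Rmin (Rmin e1 e2) (Rmin e3 e4))).
  assert (e0 : 0 < e)
    by (unfold e; repeat apply Rmin_pos; try lra; apply cond_pos).
  assert (he : e <= T /\ e <= d /\ e <= e1 /\ e <= e2 /\ e <= e3 /\ e <= e4).
  { unfold e.
    pose proof (Rmin_l (Rmin T d) (Rmin (Rmin e1 e2) (Rmin e3 e4))).
    pose proof (Rmin_r (Rmin T d) (Rmin (Rmin e1 e2) (Rmin e3 e4))).
    pose proof (Rmin_l T d); pose proof (Rmin_r T d).
    pose proof (Rmin_l (Rmin e1 e2) (Rmin e3 e4)).
    pose proof (Rmin_r (Rmin e1 e2) (Rmin e3 e4)).
    pose proof (Rmin_l e1 e2); pose proof (Rmin_r e1 e2).
    pose proof (Rmin_l e3 e4); pose proof (Rmin_r e3 e4).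
    repeat split; lra. }
  clearbody e.
  assert (boxR : forall t, 0 <= t < e -> lo <= u t <= hi /\ lo <= v t <= hi).
  { intros t ht; split; [apply h1 | apply h2];
      unfold ball; simpl; unfold AbsRing_ball, abs, minus, plus, opp; simpl;
      apply Rabs_lt_between; lra. }
  assert (boxL : forall t, T - e < t < T ->
                 lo <= A t <= hi /\ lo <= B t <= hi).
  { intros t ht; split; [apply h3 | apply h4]; try lra;
      unfold ball; simpl; unfold AbsRing_ball, abs, minus, plus, opp; simpl;
      apply Rabs_lt_between; lra. }
  assert (dL : forall t, T - e < t < T ->
    is_derive A t (dA_dt alpha (clamp lo hi (A t)) (clamp lo hi (B t))) /\
    is_derive B t (dB_dt alpha (clamp lo hi (A t)) (clamp lo hi (B t)))).
  { intros t ht; destruct (boxL t ht).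
    rewrite !clamp_id by assumption.
    apply (solution_derive alpha T); [exact sol | lra | simpl; lra]. }
  assert (dA : forall t, T - e < t < T + e -> is_derive (glue A u T) t
    (dA_dt alpha (clamp lo hi (glue A u T t)) (clamp lo hi (glue B v T t)))).
  { apply (glue_derive _ A B u v T e FL); try rewrite u0; try rewrite v0;
      try assumption; try apply cuv.
    - apply dL.
    - intros t ht; apply duv; lra. }
  assert (dB : forall t, T - e < t < T + e -> is_derive (glue B v T) t
    (dB_dt alpha (clamp lo hi (glue A u T t)) (clamp lo hi (glue B v T t)))).
  { apply (glue_derive _ B A v u T e (bounded_lipschitz_swap _ GL));
      try rewrite u0; try rewrite v0; try assumption; try apply cuv.
    - apply dL.
    - intros t ht; apply duv; lra. }
  exists (T + e), (glue A u T), (glue B v T).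
  split; [lra|]; split.
  - split; [simpl; lra|]; intros t [t0 tT]; simpl in tT.
    destruct (Rlt_le_dec t T) as [h|h].
    + destruct sol as [_ sol]; destruct (sol t) as [pA [pB [DA DB]]];
        [split; [exact t0 | exact h]|].
      rewrite !glue_left by exact h.
      split; [exact pA|]; split; [exact pB|].
      assert (loc : forall f g s, Rabs (s - t) < T - t ->
        forward_interval (T + e) s ->
        forward_interval T s /\ f s = glue f g T s).
      { intros f g s hs [s0 _]; apply Rabs_lt_between in hs.
        rewrite glue_left by lra; split; [split; simpl; lra | reflexivity]. }
      split.
      * revert DA; apply (D_in_local _ _ _ _ _ _ t (T - t)); auto;
          rewrite ?glue_left by exact h; auto; lra.
      * revert DB; apply (D_in_local _ _ _ _ _ _ t (T - t)); auto;
          rewrite ?glue_left by exact h; auto; lra.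
    + destruct (boxR (t - T)) as [bu bv]; [lra|].
      assert (gu : lo <= glue A u T t <= hi) by (rewrite glue_right; auto).
      assert (gv : lo <= glue B v T t <= hi) by (rewrite glue_right; auto).
      specialize (dA t ltac:(lra)); specialize (dB t ltac:(lra)).
      rewrite !clamp_id in dA, dB by assumption.
      split; [lra|]; split; [lra|].
      split; apply D_in_of_is_derive; assumption.
  - intros t [_ tT]; simpl in tT; rewrite !glue_left by exact tT; auto.
Qed.

(** * Monotone quantities and finite lifetime *)

Lemma increment_le_of_derive_le (f df : R -> R) (c s t : R) :
  s <= t ->
  (forall x, s <= x <= t -> is_derive f x (df x) /\ df x <= c) ->
  f t - f s <= c * (t - s).
Proof.
  intros hst h.
  destruct (MVT_gen f s t df) as [x [hx e]];
    rewrite ?Rmin_left, ?Rmax_right in * by exact hst.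
  - intros x hx; apply h; lra.
  - intros x hx; apply continuity_pt_filterlim.
    apply (ex_derive_continuous (V := R_NormedModule) f).
    exists (df x); apply h, hx.
  - rewrite e; apply Rmult_le_compat_r; [lra | apply h, hx].
Qed.

Lemma nonincreasing_limit (f : R -> R) (T : R) :
  0 < T ->
  (forall t, 0 < t < T -> 0 <= f t) ->
  (forall s t, 0 < s -> s <= t -> t < T -> f t <= f s) ->
  exists l, filterlim f (at_left T) (locally l) /\
    forall t, 0 < t < T -> l <= f t.
Proof.
  intros T0 pos mono.
  destruct (completeness (fun y => exists t, 0 < t < T /\ y = - f t))
    as [m [ub lub]].
  - exists 0; intros y [t [ht ->]]; specialize (pos t ht); lra.
  - exists (- f (T / 2)), (T / 2); split; [lra | reflexivity].
  - assert (low : forall t, 0 < t < T -> - m <= f t).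
    { intros t ht; specialize (ub (- f t)).
      assert (- f t <= m) by (apply ub; exists t; auto); lra. }
    exists (- m); split; [|exact low].
    apply filterlim_locally; intros eps.
    assert (ex : exists s, 0 < s < T /\ f s < - m + eps).
    { apply Classical_Prop.NNPP; intros no.
      assert (m <= m - eps); [|pose proof (cond_pos eps); lra].
      apply lub; intros y [t [ht ->]].
      destruct (Rlt_le_dec (f t) (- m + eps)); [|lra].
      exfalso; apply no; exists t; auto. }
    destruct ex as [s [hs fs]].
    apply (locally_interval _ T s p_infty); simpl; try tauto; try lra.
    intros t st _ tT; change (Rabs (f t - - m) < eps).
    specialize (low t ltac:(lra)); specialize (mono s t ltac:(lra)).
    apply Rabs_lt_between; lra.
Qed.

Lemma dA_dt_nonpos (alpha x y : R) :
  0 < alpha -> 0 < x -> 0 < y -> dA_dt alpha x y <= 0.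
Proof.
  intros; unfold dA_dt.
  assert (0 < (4 * x^2 * y^2 + 2 * alpha * x^3) / y^4); [|lra].
  apply Rdiv_lt_0_compat; [|apply pow_lt; assumption].
  pose proof (pow_lt x 2); pose proof (pow_lt y 2); pose proof (pow_lt x 3).
  assert (0 < x^2 * y^2) by (apply Rmult_lt_0_compat; auto).
  assert (0 < alpha * x^3) by (apply Rmult_lt_0_compat; auto).
  lra.
Qed.

(** The coefficient of [alpha / y] in [dB_dt] is [- 10 z^2 + 24 z - 16], whose
    maximum is [- 8/5], at [z = 6/5]. *)
Lemma dA_plus_dB_le (alpha x y : R) :
  0 < alpha -> 0 < x -> 0 < y -> dA_dt alpha x y + dB_dt alpha x y <= -7.
Proof.
  intros h hx hy; set (z := x / y).
  assert (z0 : 0 < z) by (apply Rdiv_lt_0_compat; assumption).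
  assert (c0 : 0 < alpha / y) by (apply Rdiv_lt_0_compat; assumption).
  replace (dA_dt alpha x y + dB_dt alpha x y)
    with (- (4 * (z - 1/2)^2) - 7
          - alpha / y * (2 * z^3 + 10 * (z - 6/5)^2 + 8/5))
    by (unfold dA_dt, dB_dt, z; field; lra).
  assert (0 <= (z - 1/2)^2) by apply pow2_ge_0.
  assert (0 <= (z - 6/5)^2) by apply pow2_ge_0.
  assert (0 < z^3) by (apply pow_lt; assumption).
  assert (0 < alpha / y * (2 * z^3 + 10 * (z - 6/5)^2 + 8/5))
    by (apply Rmult_lt_0_compat; lra).
  lra.
Qed.

Lemma sum_decay (alpha : R) (T : Rbar) (A B : R -> R) (s t : R) :
  0 < alpha -> is_solution alpha T A B -> 0 < s -> s <= t -> Rbar_lt t T ->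
  (A t + B t) - (A s + B s) <= -7 * (t - s).
Proof.
  intros h sol s0 st tT.
  apply (increment_le_of_derive_le (fun x => A x + B x)
    (fun x => dA_dt alpha (A x) (B x) + dB_dt alpha (A x) (B x))); [exact st|].
  intros x hx; destruct (solution_derive alpha T A B x) as [pA [pB [dA dB]]];
    [exact sol | lra | eapply Rbar_le_lt_trans; [|exact tT]; apply hx |].
  split; [apply (is_derive_plus A B); assumption|].
  apply dA_plus_dB_le; assumption.
Qed.

Lemma solution_time_finite (alpha : R) (T : Rbar) (A B : R -> R) :
  0 < alpha -> is_solution alpha T A B -> Rbar_lt T p_infty.
Proof.
  intros h sol; destruct T as [T| |]; simpl; try exact I.
  assert (p1 : 0 < A 1 /\ 0 < B 1).
  { destruct (solution_derive alpha p_infty A B 1) as [? [? _]];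
      auto; [lra | exact I]. }
  set (t := 1 + (A 1 + B 1)).
  assert (ht : 1 <= t) by (unfold t; lra).
  destruct (solution_derive alpha p_infty A B t) as [? [? _]];
    [exact sol | lra | exact I |].
  pose proof (sum_decay alpha p_infty A B 1 t h sol ltac:(lra) ht I).
  unfold t in *; lra.
Qed.

Lemma A_nonincreasing (alpha T : R) (A B : R -> R) (s t : R) :
  0 < alpha -> is_solution alpha T A B -> 0 < s -> s <= t -> t < T ->
  A t <= A s.
Proof.
  intros h sol s0 st tT.
  enough (A t - A s <= 0 * (t - s)) by lra.
  apply (increment_le_of_derive_le A (fun x => dA_dt alpha (A x) (B x)));
    [exact st|].
  intros x hx; destruct (solution_derive alpha T A B x) as [pA [pB [dA _]]];
    [exact sol | lra | simpl; lra |].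
  split; [exact dA | apply dA_dt_nonpos; assumption].
Qed.

(** * The limit at the final time *)

(** The derivative of [1 / A] is [4 / B^2 + 2 alpha A / B^4], which stays bounded
    when [B] is bounded away from 0 and [A] is bounded. *)
Lemma limit_A_pos (alpha T : R) (A B : R -> R) (a b : R) :
  0 < alpha -> is_solution alpha T A B ->
  filterlim A (at_left T) (locally a) -> filterlim B (at_left T) (locally b) ->
  0 < b -> 0 < a.
Proof.
  intros h sol hA hB b0.
  assert (T0 : 0 < T) by (destruct sol as [T0 _]; exact T0).
  destruct (eventually_between _ B b (b / 2) (2 * b) hB ltac:(lra)) as [r hr].
  set (s := Rmax (T / 2) (T - r / 2)).
  pose proof (cond_pos r) as r0.
  assert (hs : 0 < s < T).
  { unfold s, Rmax; destruct (Rle_dec _ _); lra. }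
  assert (Bs : forall x, s <= x < T -> b / 2 <= B x).
  { intros x hx; apply hr; [|lra].
    change (Rabs (x - T) < r); apply Rabs_lt_between.
    pose proof (Rmax_r (T / 2) (T - r / 2)); fold s in H; lra. }
  destruct (solution_derive alpha T A B s) as [As0 _]; auto; [lra | simpl; lra |].
  set (K := 4 / (b/2)^2 + 2 * alpha * A s / (b/2)^4).
  assert (K0 : 0 < K).
  { assert (0 < b / 2) by lra.
    apply Rplus_lt_0_compat; apply Rdiv_lt_0_compat; try apply pow_lt; auto;
      [lra|].
    apply Rmult_lt_0_compat; lra. }
  set (Q := / A s + K * (T - s)).
  assert (Q0 : 0 < Q).
  { apply Rplus_lt_0_compat; [apply Rinv_0_lt_compat, As0|].
    apply Rmult_lt_0_compat; lra. }
  assert (bound : forall t, s <= t < T -> / Q <= A t).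
  { intros t ht.
    destruct (solution_derive alpha T A B t) as [At0 _];
      [exact sol | lra | simpl; lra |].
    rewrite <- (Rinv_inv (A t)); apply Rinv_le_contravar.
    { apply Rinv_0_lt_compat, At0. }
    assert (/ A t - / A s <= K * (t - s)).
    { apply (increment_le_of_derive_le (fun x => / A x)
        (fun x => 4 / B x ^ 2 + 2 * alpha * A x / B x ^ 4)); [lra|].
      intros x hx.
      destruct (solution_derive alpha T A B x) as [pA [pB [dA _]]];
        [exact sol | lra | simpl; lra |].
      split.
      - replace (4 / B x ^ 2 + 2 * alpha * A x / B x ^ 4)
          with (- dA_dt alpha (A x) (B x) / A x ^ 2)
          by (unfold dA_dt; field; lra).
        apply is_derive_inv; [exact dA | lra].
      - assert (hB' : b / 2 <= B x) by (apply Bs; lra).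
        assert (hA' : A x <= A s)
          by (apply (A_nonincreasing alpha T A B); auto; lra).
        assert (inv : forall n, 0 <= / B x ^ n <= / (b/2)^n).
        { intros n; split.
          - left; apply Rinv_0_lt_compat, pow_lt, pB.
          - apply Rinv_le_contravar; [apply pow_lt; lra|].
            apply pow_incr; lra. }
        unfold K, Rdiv at 1 2 3 5; apply Rplus_le_compat.
        + apply Rmult_le_compat_l; [lra | apply inv].
        + apply Rmult_le_compat; try apply inv; [|].
          * apply Rmult_le_pos; lra.
          * apply Rmult_le_compat_l; lra. }
    unfold Q; nra. }
  apply Rlt_le_trans with (/ Q); [apply Rinv_0_lt_compat, Q0|].
  apply (filterlim_le (F := at_left T) (fun _ => / Q) A (/ Q) a).
  - apply (locally_interval _ T s p_infty); simpl; try tauto; try lra.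
    intros t st _ tT; apply bound; lra.
  - apply filterlim_const.
  - exact hA.
Qed.

(** The right-hand side is [x^6] times the derivative of [B / A^5] along the flow.
    The exponent 5 is the ratio of the leading coefficients [- 10 alpha] and
    [- 2 alpha], and cancels the cubic term in [z]; what is left is
    [8 x ((3 z - 1) + (alpha / y) (3 z - 2))]. *)
Lemma B_over_A5_rate_nonneg (alpha x y : R) :
  0 < alpha -> 0 < y <= x ->
  0 <= (dB_dt alpha x y * x - 5 * y * dA_dt alpha x y).
Proof.
  intros h [hy hyx]; set (z := x / y).
  assert (z1 : 1 <= z).
  { apply (Rmult_le_reg_r y); [exact hy|].
    unfold z; replace (x / y * y) with x by (field; lra); lra. }
  assert (c0 : 0 < alpha / y) by (apply Rdiv_lt_0_compat; assumption).
  replace (dB_dt alpha x y * x - 5 * y * dA_dt alpha x y)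
    with (8 * x * ((3 * z - 1) + alpha / y * (3 * z - 2)))
    by (unfold dA_dt, dB_dt, z; field; lra).
  apply Rmult_le_pos; [lra|].
  assert (0 <= alpha / y * (3 * z - 2)) by (apply Rmult_le_pos; lra).
  lra.
Qed.

(** Suppose [a > 0]. Near [T] one has [B <= a <= A], so [B / A^5] no longer
    decreases and [B] stays above [c * a^5] for some [c > 0]. *)
Lemma limit_A_nonpos (alpha T : R) (A B : R -> R) (a : R) :
  0 < alpha -> is_solution alpha T A B ->
  filterlim A (at_left T) (locally a) -> filterlim B (at_left T) (locally 0) ->
  (forall t, 0 < t < T -> a <= A t) -> a <= 0.
Proof.
  intros h sol hA hB low.
  apply Rnot_lt_le; intros a0.
  assert (T0 : 0 < T) by (destruct sol as [T0 _]; exact T0).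
  destruct (eventually_between _ B 0 (- a) a hB ltac:(lra)) as [r hr].
  set (s := Rmax (T / 2) (T - r / 2)).
  pose proof (cond_pos r) as r0.
  assert (hs : 0 < s < T).
  { unfold s, Rmax; destruct (Rle_dec _ _); lra. }
  assert (BA : forall x, s <= x < T -> B x <= A x).
  { intros x hx; apply Rle_trans with a; [|apply low; lra].
    apply hr; [|lra].
    change (Rabs (x - T) < r); apply Rabs_lt_between.
    pose proof (Rmax_r (T / 2) (T - r / 2)); fold s in H; lra. }
  destruct (solution_derive alpha T A B s) as [As0 [Bs0 _]];
    [exact sol | lra | simpl; lra |].
  set (c := B s / A s ^ 5).
  assert (c0 : 0 < c)
    by (apply Rdiv_lt_0_compat; [|apply pow_lt]; assumption).
  assert (bound : forall t, s <= t < T -> c * a ^ 5 <= B t).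
  { intros t ht.
    destruct (solution_derive alpha T A B t) as [At0 [Bt0 _]];
      [exact sol | lra | simpl; lra |].
    assert (- (B t / A t ^ 5) - - (B s / A s ^ 5) <= 0 * (t - s)).
    { apply (increment_le_of_derive_le (fun x => - (B x / A x ^ 5))
        (fun x => - ((dB_dt alpha (A x) (B x) * A x
                      - 5 * B x * dA_dt alpha (A x) (B x)) / A x ^ 6)));
        [lra|].
      intros x hx.
      destruct (solution_derive alpha T A B x) as [pA [pB [dA dB]]];
        [exact sol | lra | simpl; lra |].
      split.
      - auto_derive.
        + repeat split; try (eexists; eassumption).
          apply Rgt_not_eq; simpl; repeat apply Rmult_lt_0_compat; lra.
        + change (Derive (fun y : R => A y) x) with (Derive A x).
          change (Derive (fun y : R => B y) x) with (Derive B x).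
          rewrite (is_derive_unique _ _ _ dA), (is_derive_unique _ _ _ dB).
          field; lra.
      - assert (0 <= (dB_dt alpha (A x) (B x) * A x
                      - 5 * B x * dA_dt alpha (A x) (B x)) / A x ^ 6); [|lra].
        apply Rdiv_le_0_compat; [|apply pow_lt, pA].
        apply B_over_A5_rate_nonneg; [exact h|].
        split; [exact pB | apply BA; lra]. }
    fold c in H.
    assert (e : B t = B t / A t ^ 5 * A t ^ 5)
      by (field; apply Rgt_not_eq, At0).
    rewrite e; apply Rmult_le_compat; try lra.
    - apply pow_le; lra.
    - apply pow_incr; split; [lra | apply low; lra]. }
  assert (pos : 0 < c * a ^ 5)
    by (apply Rmult_lt_0_compat; [|apply pow_lt]; assumption).
  apply (Rlt_not_le _ _ pos).
  apply (filterlim_le (F := at_left T) (fun _ => c * a ^ 5) B (c * a ^ 5) 0).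
  - apply (locally_interval _ T s p_infty); simpl; try tauto; try lra.
    intros t st _ tT; apply bound; lra.
  - apply filterlim_const.
  - exact hB.
Qed.

Theorem theorem1 (alpha : R) (halpha : 0 < alpha)
    (A0 B0 : R) (hA0 : 0 < A0) (hB0 : 0 < B0)
    (tmax : Rbar) (A B : R -> R)
    (hsol : is_maximal_solution alpha tmax A B)
    (hA : A 0 = A0) (hB : B 0 = B0) :
  Rbar_lt tmax p_infty /\
  filterlim (fun t : R => (A t, B t)) (at_left (real tmax))
    (locally ((0, 0) : R * R)).
Proof.
  destruct hsol as [sol maximal].
  pose proof (solution_time_finite alpha tmax A B halpha sol) as fin.
  split; [exact fin|].
  assert (T0 : Rbar_lt 0 tmax) by apply sol.
  destruct tmax as [T| |]; simpl in fin, T0; try tauto; simpl real.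
  assert (pos : forall t, 0 < t < T -> 0 < A t /\ 0 < B t).
  { intros t ht; destruct (solution_derive alpha T A B t) as [? [? _]];
      [exact sol | lra | simpl; lra | auto]. }
  destruct (nonincreasing_limit A T T0) as [a [la lowA]].
  { intros t ht; destruct (pos t ht); lra. }
  { intros s t; apply (A_nonincreasing alpha T A B s t halpha sol). }
  destruct (nonincreasing_limit (fun t => A t + B t) T T0) as [l [ll _]].
  { intros t ht; destruct (pos t ht); lra. }
  { intros s t s0 st tT.
    pose proof (sum_decay alpha T A B s t halpha sol s0 st tT); lra. }
  assert (lb : filterlim B (at_left T) (locally (l - a))).
  { apply (filterlim_ext (fun t => (A t + B t) - A t)); [intros; ring|].
    apply (filterlim_comp_2 (G := locally l) (H := locally (opp a))
             (fun t => A t + B t) (fun t => opp (A t)) plus);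
      [exact ll | | apply (filterlim_plus l (opp a))].
    apply (filterlim_comp _ _ _ A opp _ (locally a)); [exact la|].
    apply (filterlim_opp a). }
  assert (near : forall P : R -> Prop,
    (forall t, 0 < t < T -> P t) -> at_left T P).
  { intros P hP; apply (locally_interval _ T 0 p_infty); simpl; try tauto.
    intros t t0 _ tT; apply hP; lra. }
  assert (nonneg : forall (f : R -> R) c, (forall t, 0 < t < T -> 0 < f t) ->
    filterlim f (at_left T) (locally c) -> 0 <= c).
  { intros f c hf hc.
    apply (filterlim_le (F := at_left T) (fun _ => 0) f 0 c).
    - apply near; intros t ht; left; apply hf, ht.
    - apply filterlim_const.
    - exact hc. }
  assert (a0 : 0 <= a) by (apply (nonneg A); [apply pos | exact la]).
  assert (b0 : 0 <= l - a) by (apply (nonneg B); [apply pos | exact lb]).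
  destruct (Rlt_le_dec 0 (l - a)) as [bpos|bneg].
  - exfalso.
    assert (apos : 0 < a) by (apply (limit_A_pos alpha T A B a (l - a)); auto).
    destruct (solution_extends alpha T A B a (l - a))
      as [T' [A' [B' [TT' [sol' agree]]]]]; auto.
    specialize (maximal T' A' B' sol' agree); simpl in maximal; lra.
  - assert (b_eq : l - a = 0) by lra; rewrite b_eq in lb.
    assert (a_eq : a = 0).
    { apply Rle_antisym; [|exact a0].
      apply (limit_A_nonpos alpha T A B a); auto. }
    rewrite a_eq in la.
    apply filterlim_locally; intros eps.
    generalize (filter_and _ _
      (proj1 (filterlim_locally _ _) la eps)
      (proj1 (filterlim_locally _ _) lb eps)).
    apply filter_imp; intros t [h1 h2]; split; assumption.
Qed.
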